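(* For each odd positive integer $n$, the function $\alpha\mapsto E_n(\alpha)$ has a local maximum at $\alpha=0$.
   Context: For $\alpha\in(-1,1)$ let $f(x;\alpha)=|x-\alpha|$, $x\in[-1,1]$. Let $\mathbb{P}_n$ be the space of real polynomials of degree at most $n$, $\|\cdot\|$ the uniform norm on $[-1,1]$, and $E_n(\alpha)=\min_{q\in\mathbb{P}_n}\|f(\cdot;\alpha)-q\|$. *)

(* Defs.v *)
From mathcomp Require Import all_boot all_order all_algebra.
From mathcomp Require Import all_classical all_reals all_analysis.
From mathcomp Require Import ring lra.

Set Implicit Arguments.
Unset Strict Implicit.
Unset Printing Implicit Defensive.

Import Order.TTheory GRing.Theory Num.Theory.
Import numFieldNormedType.Exports.

Local Open Scope classical_set_scope.
Local Open Scope ring_scope.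

(* Meaningful only for [g] bounded on [-1, 1]: [sup] of an unbounded set is 0. *)
Definition unorm (R : realType) (g : R -> R) : R :=
  sup [set `|g x| | x in `[-1, 1]%classic].

Definition shifted_abs (R : realType) (a x : R) : R := `|x - a|.

(* [size q <= n.+1] means that [q] has degree at most [n].  The infimum is a
   minimum: see [best_error_attained]. *)
Definition best_error (R : realType) (n : nat) (a : R) : R :=
  inf [set unorm (fun x => shifted_abs a x - q.[x])
      | q in [set q : {poly R} | (size q <= n.+1)%N]].

Section Attained.
Variable R : realType.
Implicit Types (g h : R -> R) (p q : {poly R}).

Definition bounded11 g := exists M, forall x, x \in `[-1, 1] -> `|g x| <= M.

Lemma unorm_ge g x : bounded11 g -> x \in `[-1, 1] -> `|g x| <= unorm g.
Proof.
move=> [M gM] xI; apply: sup_ubound; last by exists x.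
by exists M => _ [y yI <-]; exact: gM.
Qed.

Lemma unorm_le g M : (forall x, x \in `[-1, 1] -> `|g x| <= M) -> unorm g <= M.
Proof.
move=> gM; apply: ge_sup; last by move=> _ [y yI <-]; exact: gM.
by exists `|g 0|; exists 0 => //=; rewrite in_itv/= lerN10 ler01.
Qed.

Lemma unorm_ge0 g : bounded11 g -> 0 <= unorm g.
Proof.
move=> gb; apply: le_trans (normr_ge0 (g 0)) (unorm_ge gb _).
by rewrite in_itv/= lerN10 ler01.
Qed.

Lemma bounded11_poly p : bounded11 (fun x => p.[x]).
Proof.
exists (\sum_(i < size p) `|p`_i|) => x; rewrite in_itv/= -ler_norml => x1.
rewrite horner_coef (le_trans (ler_norm_sum _ _ _))//.
apply: ler_sum => i _; rewrite normrM normrX ler_piMr//.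
exact: exprn_ile1.
Qed.

Lemma bounded11B g h :
  bounded11 g -> bounded11 h -> bounded11 (fun x => g x - h x).
Proof.
move=> [M gM] [N hN]; exists (M + N) => x xI.
by rewrite (le_trans (ler_normB _ _))// lerD ?gM ?hN.
Qed.

Lemma bounded11_shifted_abs a : bounded11 (shifted_abs a).
Proof.
exists (1 + `|a|) => x; rewrite in_itv/= -ler_norml => x1.
by rewrite normr_id (le_trans (ler_normB _ _))// lerD2r.
Qed.

Definition node (i : nat) : R := i.+1%:R^-1.

Lemma node_inj : injective node.
Proof. by move=> i j /invr_inj /eqP; rewrite eqr_nat => /eqP[]. Qed.

Lemma node_in i : node i \in `[-1, 1].
Proof.
rewrite in_itv/= -ler_norml ger0_norm ?invr_ge0//.
by rewrite invf_le1 ?ltr0n// ler1n.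
Qed.

Let lag (n : nat) (i : 'I_n.+1) : {poly R} := tnth (@lagrange R n.+1 node) i.

Definition interp (n : nat) (v : 'rV[R]_n.+1) : {poly R} :=
  \sum_(i < n.+1) v ord0 i *: lag i.

Lemma size_interp n (v : 'rV[R]_n.+1) : (size (interp v) <= n.+1)%N.
Proof.
apply: (leq_trans (size_sum _ _ _)); apply/bigmax_leqP => i _.
by rewrite (leq_trans (size_scale_leq _ _))// size_lagrange_//; exact: node_inj.
Qed.

Lemma interpE n p : (size p <= n.+1)%N ->
  p = interp (\row_(i < n.+1) p.[node i]).
Proof.
move=> sp; rewrite [LHS](lagrange_gen _ node_inj sp)//.
by apply: eq_bigr => i _; rewrite mxE mul_polyC.
Qed.

Lemma best_error_attained n a :
  exists2 q : {poly R}, (size q <= n.+1)%N &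
    unorm (fun x => shifted_abs a x - q.[x]) = best_error n a.
Proof.
pose f := shifted_abs a.
have fb := bounded11_shifted_abs a.
have eb q : bounded11 (fun x => f x - q.[x]).
  by apply: bounded11B => //; exact: bounded11_poly.
pose F (v : 'rV[R]_n.+1) := unorm (fun x => f x - (interp v).[x]).
pose L := \sum_(i < n.+1) unorm (fun x => (lag i).[x]).
have L0 : 0 <= L.
  by apply: sumr_ge0 => i _; apply: unorm_ge0; exact: bounded11_poly.
have mxle (v : 'rV[R]_n.+1) i : `|v ord0 i| <= `|v|.
  rewrite [leRHS]/Num.norm/= mx_normrE; apply/bigmax_geP; right => /=.
  by exists (ord0, i).
have Flip v w : F v <= F w + L * `|v - w|.
  apply: unorm_le => x xI.
  have -> : f x - (interp v).[x] =
      (f x - (interp w).[x]) + (interp w - interp v).[x] by rewrite hornerD hornerN; ring.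
  rewrite (le_trans (ler_normD _ _))// lerD ?(unorm_ge (eb _))//.
  rewrite /interp -sumrB horner_sum (le_trans (ler_norm_sum _ _ _))//.
  rewrite /L mulr_suml; apply: ler_sum => i _.
  rewrite -scalerBl hornerZ normrM mulrC distrC ler_pM//.
    by apply: unorm_ge => //; exact: bounded11_poly.
  by have := mxle (v - w) i; rewrite !mxE.
have Fcont : continuous F.
  move=> v; apply/(@cvgrPdist_lt _ _ _ _ (nbhs_filter v)) => e e0.
  apply/nbhs_ballP.
  exists (e / (L + 1)) => [|w]; first by rewrite /= divr_gt0// ltr_wpDl.
  rewrite -ball_normE /=.
  rewrite ltr_pdivlMr ?ltr_wpDl// mulrC => vw'.
  have {vw'} vw : L * `|v - w| < e.
    by apply: le_lt_trans vw'; rewrite ler_wpM2r// lerDl.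
  apply: le_lt_trans vw.
  have := Flip v w; have := Flip w v; rewrite (distrC w v).
  by rewrite ler_norml => ? ?; lra.
pose C := unorm f + unorm f.
have f0 : 0 <= unorm f by exact: unorm_ge0.
pose K := [set v : 'rV[R]_n.+1 | forall i, v ord0 i \in `[- C, C]].
have Kcpt : compact K.
  apply: (@rV_compact _ _ (fun=> `[- C, C]%classic)) => _.
  exact: segment_compact.
have K0 : K 0.
  by move=> i; rewrite mxE in_itv/= oppr_le0 andbb addr_ge0.
have [v vK vmin] := @EVT_min_rV R n.+1 F K (ex_intro _ _ K0) Kcpt
  (continuous_subspaceT Fcont).
exists (interp v); first exact: size_interp.
have minv q : (size q <= n.+1)%N -> F v <= unorm (fun x => f x - q.[x]).
  move=> sq; have [qf|fq] := leP (unorm (fun x => f x - q.[x])) (unorm f).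
    rewrite {1}(interpE sq); apply: vmin; rewrite inE => i.
    rewrite mxE in_itv/= -ler_norml.
    have -> : q.[node i] = f (node i) - (f (node i) - q.[node i]) by ring.
    rewrite (le_trans (ler_normB _ _))// lerD// ?(unorm_ge fb) ?node_in//.
    by rewrite (le_trans (unorm_ge (eb _) (node_in _))).
  apply: le_trans (ltW fq); apply: le_trans (vmin 0 _) _; first by rewrite inE.
  rewrite /F; apply: unorm_le => x xI.
  rewrite /interp big1 ?horner0 ?subr0 ?(unorm_ge fb)// => i _.
  by rewrite mxE scale0r.
apply/eqP; rewrite eq_le; apply/andP; split.
  apply: lb_le_inf; last by move=> _ [q /= sq <-]; exact: minv.
  by exists (F v); exists (interp v) => //; exact: size_interp.
apply: ge_inf; last by exists (interp v) => //; exact: size_interp.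
by exists (F v) => _ [q /= sq <-]; exact: minv.
Qed.

End Attained.

(* Main.v *)
Require Import Defs.
From mathcomp Require Import all_boot all_order all_algebra.
From mathcomp Require Import all_classical all_reals all_analysis.
From mathcomp Require Import ring lra.
Import Order.TTheory GRing.Theory Num.Theory.
Import numFieldNormedType.Exports.
Local Open Scope classical_set_scope.
Local Open Scope ring_scope.

Set Implicit Arguments.
Unset Strict Implicit.
Unset Printing Implicit Defensive.

(* Let [n = 2m + 1] and let [e x = x - p (x ^+ 2)] be the error on [0, 1] of the
   even best approximation of [|x|], with [E = best_error n 0].  Every interior
   extremal point is a zero of [e'], which has at most [m] positive zeros, whereas
   Kolmogorov's criterion requires at least [m + 2] extremal points in [0, 1]; so
   they are 0, 1 and [x_1, ..., x_m], the zeros of [e'].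
   Put [M x = \prod_i (x ^+ 2 - x_i ^+ 2)] and [W = e' 1 / M 1 * M].  In the
   variable [X = x - a] the polynomial
   [p (X ^+ 2) - a X W X - a ^+ 2 / 2 * X W' X], of degree at most [n], has at [X]
   the error [perturb e W (sgn X * a) |X|] with
   [perturb e W b y = e y + b y W y + b ^+ 2 / 2 * y W' y] and
   [0 <= y <= 1 - b].  The term [b y W y] cancels the first order variation of
   the error at the ends of the interval.  The second order terms then keep
   [|perturb e W b y| <= E] for small [b] because [W / e'] increases to its value
   1 at the point 1.  The reason is that [e'] is [1 - y R (y ^+ 2)] with [R] the
   polynomial interpolating [1 / y] at the [x_i], so that, up to sign, [e' / M] is
   a positive combination of products of functions [1 / (y + c)], [c > 0]. *)

(** * Sign and monotonicity of the error in interpolating [1 / x] *)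

Section PositiveDecreasing.
Variable R : realFieldType.
Implicit Types (f g : R -> R) (p q r : {poly R}) (s : seq R).

(** Positive combinations of finite products of functions [1 / (x + b)], [b > 0]. The generators
    allow positivity, monotonicity and the addition of a node each to be proved by one induction. *)
Inductive recip_cone : (R -> R) -> Prop :=
| recip_cone1 : recip_cone (fun=> 1)
| recip_cone_div f b : 0 < b -> recip_cone f -> recip_cone (fun x => f x / (x + b))
| recip_coneD f g : recip_cone f -> recip_cone g -> recip_cone (fun x => f x + g x)
| recip_coneZ f c : 0 < c -> recip_cone f -> recip_cone (fun x => c * f x).

Lemma recip_cone_gt0 f x : recip_cone f -> 0 < x -> 0 < f x.
Proof.
move=> + x0; elim=> [|{}f b b0 _ f0|{}f g _ f0 _ g0|{}f c c0 _ f0] //.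
- by rewrite divr_gt0// addr_gt0.
- by rewrite addr_gt0.
- by rewrite mulr_gt0.
Qed.

Lemma recip_cone_nonincreasing f x y :
  recip_cone f -> 0 < x -> x <= y -> f y <= f x.
Proof.
move=> + x0 xy; elim=> [|{}f b b0 Cf fyx|{}f g _ f0 _ g0|{}f c c0 _ f0] //.
- have y0 := lt_le_trans x0 xy.
  rewrite ler_pM ?invr_ge0 ?(ltW (recip_cone_gt0 Cf _)) ?addr_ge0 ?(ltW b0) ?(ltW y0)//.
  by rewrite lef_pV2 ?posrE ?addr_gt0// lerD2r.
- exact: lerD.
- by rewrite ler_pM2l.
Qed.

(** The quotient of [x / a * f a - f x] by [x ^+ 2 - a ^+ 2] stays in the cone: for [f = 1] it is
    [1 / (a * (x + a))], and dividing [f] by [x + b] turns a quotient [g] into [(g x + f x / (x + a)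
    / (x + b)) / (a + b)]. *)
Lemma recip_cone_step f a : 0 < a -> recip_cone f ->
  exists2 g, recip_cone g &
    forall x, 0 < x -> g x * (x ^+ 2 - a ^+ 2) = x / a * f a - f x.
Proof.
move=> a0; elim=> [|{}f b b0 Cf [g Cg gE]|f1 f2 _ [g1 C1 g1E] _ [g2 C2 g2E]
  |{}f c c0 _ [g Cg gE]].
- exists (fun x => a^-1 * (1 / (x + a))) => [|x x0].
    apply: (recip_coneZ (f := fun x => 1 / (x + a))); first by rewrite invr_gt0.
    exact: (recip_cone_div a0 recip_cone1).
  by field; rewrite !gt_eqF// addr_gt0.
- exists (fun x => (a + b)^-1 * (g x + f x / (x + a) / (x + b))) => [|x x0].
    apply: (recip_coneZ (f := fun x => g x + f x / (x + a) / (x + b))).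
      by rewrite invr_gt0 addr_gt0.
    apply: (recip_coneD (g := fun x => f x / (x + a) / (x + b))) => //.
    apply: (recip_cone_div (f := fun x => f x / (x + a))) => //.
    exact: recip_cone_div.
  have := gE x x0.
  have -> : (a + b)^-1 * (g x + f x / (x + a) / (x + b)) * (x ^+ 2 - a ^+ 2) =
    (g x * (x ^+ 2 - a ^+ 2) + f x * (x - a) / (x + b)) / (a + b).
    by field; rewrite !gt_eqF// addr_gt0.
  by move=> ->; field; rewrite !gt_eqF// addr_gt0.
- exists (fun x => g1 x + g2 x) => [|x x0]; first exact: recip_coneD.
  by rewrite /= mulrDl g1E// g2E//; ring.
- exists (fun x => c * g x) => [|x x0]; first exact: recip_coneZ.
  by rewrite /= -(mulrA c) gE//; ring.
Qed.

Lemma prod_XsubC_neq0 s a : a \notin s -> (\prod_(b <- s) ('X - b%:P)).[a] != 0.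
Proof. by move=> as_; rewrite -rootE root_prod_XsubC. Qed.

Lemma poly_interpolation s f : uniq s ->
  exists2 p : {poly R}, (size p <= size s)%N & forall x, x \in s -> p.[x] = f x.
Proof.
elim: s => [|a s IH] /= => [_|/andP[as_ us]].
  by exists 0; rewrite ?size_poly0.
have [p sp pE] := IH us.
have aP := prod_XsubC_neq0 as_.
set P := \prod_(b <- s) _ in aP.
exists (p + ((f a - p.[a]) / P.[a]) *: P) => [|x].
  rewrite (leq_trans (size_polyD _ _))// geq_max (leq_trans sp)//=.
  by rewrite (leq_trans (size_scale_leq _ _))// size_prod_XsubC.
rewrite inE hornerD hornerZ => /predU1P[->|xs]; first by field.
have /rootP -> : root P x by rewrite root_prod_XsubC.
by rewrite mulr0 addr0 pE.
Qed.

Lemma horner_prod_sqr s x :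
  (\prod_(a <- s) ('X - (a ^+ 2)%:P)).[x ^+ 2] = \prod_(a <- s) (x ^+ 2 - a ^+ 2).
Proof. by rewrite horner_prod; apply: eq_bigr => a _; rewrite !hornerE. Qed.

(* The sign-free factor [f] is built one node at a time: adding the node [a]
   changes the interpolant by a multiple of [\prod_(b <- s) (x ^+ 2 - b ^+ 2)],
   which turns [f x] into [f x - x / a * f a]. *)
Lemma inv_interpolation_error s r :
  uniq s -> (forall a, a \in s -> 0 < a) -> (size r <= size s)%N ->
  (forall a, a \in s -> a * r.[a ^+ 2] = 1) ->
  exists2 f, recip_cone f & forall x, 0 < x ->
    1 - x * r.[x ^+ 2] =
    (-1) ^+ size s * f x * \prod_(a <- s) (x ^+ 2 - a ^+ 2).
Proof.
elim: s r => [|a s IH] r /=.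
  move=> _ _; rewrite leqn0 size_poly_eq0 => /eqP -> _.
  exists (fun=> 1); first exact: recip_cone1.
  by move=> x _; rewrite horner0 big_nil; ring.
move=> /andP[as_ us] s0 sr rE.
have a0 : 0 < a by rewrite s0 ?mem_head.
pose P := \prod_(b <- s) ('X - (b ^+ 2)%:P).
have mP : P \is monic by apply: monic_prod_XsubC.
have sP : size P = (size s).+1 by rewrite size_prod_XsubC.
(* Subtracting [B *: P] lowers the degree and keeps the values at the squares of the nodes in
   [s]. *)
pose B := r`_(size s); pose r' := r - B *: P.
have sr' : (size r' <= size s)%N.
  apply/leq_sizeP => j; rewrite leq_eqVlt => /predU1P[<-|sj].
    rewrite coefB coefZ; have /monicP := mP; rewrite lead_coefE sP /= => ->.
    by rewrite mulr1 subrr.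
  by rewrite coefB coefZ !nth_default ?mulr0 ?subr0// ?sP// (leq_trans sr).
have PE x : P.[x ^+ 2] = \prod_(b <- s) (x ^+ 2 - b ^+ 2).
  exact: horner_prod_sqr.
have [b bs|b bs|f Cf fE] := IH r' us _ sr'.
- by rewrite s0// inE bs orbT.
- rewrite hornerD hornerN hornerZ PE (big_rem b)//= subrr mul0r mulr0 subr0.
  by rewrite rE// inE bs orbT.
have Pa : P.[a ^+ 2] != 0.
  rewrite PE prodf_seq_neq0; apply/allP => b bs /=.
  rewrite subr_eq0 eqrXn2 ?(ltW a0) ?ltW ?s0 ?inE ?bs ?orbT//.
  by apply: contraNN as_ => /eqP ->.
(* This is the error formula for [r'] at the new node [a], where [r] itself has no error. *)
have aB : (-1) ^+ size s * f a = a * B.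
  apply: (mulIf Pa); rewrite {1}PE -fE// /r' hornerD hornerN hornerZ.
  by rewrite -(rE a (mem_head _ _)); ring.
have [g Cg gE] := recip_cone_step a0 Cf.
exists g => // x x0; rewrite big_cons.
have -> : 1 - x * r.[x ^+ 2] = (1 - x * r'.[x ^+ 2]) - x / a * (a * B) * P.[x ^+ 2].
  by rewrite /r' hornerD hornerN hornerZ; field; rewrite gt_eqF.
rewrite fE// -aB PE (exprS (-1)).
transitivity (- (-1) ^+ size s * (g x * (x ^+ 2 - a ^+ 2)) *
  \prod_(b <- s) (x ^+ 2 - b ^+ 2)); last by ring.
by rewrite gE//; ring.
Qed.

(** If [r] were smaller, it would already be the interpolant at all nodes but one; its error formula
    has no positive zero outside those nodes, so the remaining node could not be interpolated.
    Applied to the derivative of an even error, this bounds the number of interior extremal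
    points. *)
Lemma inv_interpolation_size s r :
  uniq s -> (forall a, a \in s -> 0 < a) ->
  (forall a, a \in s -> a * r.[a ^+ 2] = 1) -> (size s <= size r)%N.
Proof.
move=> us s0 rE; rewrite leqNgt; apply/negP => sr.
have sr' : (size r <= size s)%N by apply: ltnW.
case: s us s0 rE sr sr' => [//|a s] /= /andP[as_ us] s0 rE; rewrite ltnS => sr _.
have a0 : 0 < a by rewrite s0 ?mem_head.
have [b bs|b bs|f Cf fE] := inv_interpolation_error us _ sr.
- by rewrite s0// inE bs orbT.
- by rewrite rE// inE bs orbT.
have := fE a a0; rewrite rE ?mem_head// subrr => /esym/eqP.
rewrite !mulf_eq0 signr_eq0 (gt_eqF (recip_cone_gt0 Cf a0))/=.
rewrite prodf_seq_eq0 => /hasP[b bs] /=.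
rewrite subr_eq0 eqrXn2 ?(ltW a0) ?ltW ?s0 ?inE ?bs ?orbT// => /eqP ab.
by rewrite ab bs in as_.
Qed.

End PositiveDecreasing.

(** * Small perturbations of the error near each point *)

Section Local.
Variable R : realType.
Implicit Types (p q e W : {poly R}) (a x y b : R).

Lemma near2_horner_gt0 p q r a : 0 < p.[a] ->
  \forall x \near a & b \near (0 : R), 0 < p.[x] + b * q.[x] + b ^+ 2 * r.[x].
Proof.
move=> pa.
have cp (u : {poly R}) : (fun z : R * R => u.[z.1]) @ (a, 0) --> u.[a].
  apply: (@cvg_comp _ _ _ (@fst R R) (horner u) _ (nbhs a)); first exact: cvg_fst.
  exact: continuous_horner.
have cb : (fun z : R * R => z.2) @ (a, 0 : R) --> (0 : R) by exact: cvg_snd.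
have : (fun z : R * R => p.[z.1] + z.2 * q.[z.1] + z.2 ^+ 2 * r.[z.1]) @ (a, 0)
    --> p.[a] + 0 * q.[a] + (0 * 0) * r.[a].
  apply: cvgD; first by apply: cvgD => //; exact: cvgM.
  by apply: cvgM => //; exact: cvgM.
rewrite !mul0r !addr0 => /cvgr_gt /(_ _ pa).
exact.
Qed.

Lemma near_horner_gt0 p a : 0 < p.[a] -> \forall x \near a, 0 < p.[x].
Proof. by move=> pa; apply: (cvgr_gt _ (@continuous_horner _ p a)). Qed.

Lemma horner_ge0_right p a c : a < c ->
  (forall x, a < x < c -> 0 <= p.[x]) -> 0 <= p.[a].
Proof.
move=> ac p0; rewrite leNgt -oppr_gt0 -hornerN; apply/negP => /near_horner_gt0.
rewrite -nbhs_nearE => /nbhs_ballP[d /= d0 dp].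
pose x := a + Num.min (d / 2) ((c - a) / 2).
have h : 0 < Num.min (d / 2) ((c - a) / 2).
  by rewrite lt_min !divr_gt0// subr_gt0.
have : ball a d x.
  rewrite -ball_normE /= distrC /x addrAC subrr add0r gtr0_norm//.
  by rewrite gt_min ltr_pdivrMr// mulr_natr mulr2n ltrDl d0.
move/dp; rewrite hornerN oppr_gt0 ltNge p0//.
rewrite /x ltrDl h -ltrBrDl gt_min; apply/orP; right.
by rewrite ltr_pdivrMr// mulr_natr mulr2n ltrDl subr_gt0.
Qed.

Lemma horner_ge0_left p a c : c < a ->
  (forall x, c < x < a -> 0 <= p.[x]) -> 0 <= p.[a].
Proof.
move=> ca p0; have -> : p.[a] = (p \Po - 'X).[- a].
  by rewrite horner_comp !hornerE opprK.
apply: (@horner_ge0_right _ _ (- c)); first by rewrite ltrN2.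
by move=> x /andP[ax xc]; rewrite horner_comp !hornerE p0// ltrNr xc ltrNl.
Qed.

Lemma root_factor p a : root p a ->
  exists2 q : {poly R}, p = q * ('X - a%:P) & q.[a] = p^`().[a].
Proof.
move=> /factor_theorem[q ->]; exists q => //.
by rewrite derivM derivXsubC !hornerE subrr mulr0 add0r.
Qed.

(** The quotient of [p - p.[a]] by ['X - a] is nonnegative to the left of [a] and nonpositive to the
    right, so it vanishes at [a] and a second factor splits off. *)
Lemma interior_max_deriv p a :
  0 < a < 1 -> (forall x, 0 <= x <= 1 -> p.[x] <= p.[a]) ->
  exists2 q : {poly R}, p = p.[a]%:P + q * ('X - a%:P) ^+ 2 &
    p^`().[a] = 0 /\ p^`()^`().[a] = 2 * q.[a] /\ q.[a] <= 0.
Proof.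
move=> /andP[a0 a1] pa.
have [|q pE q1] := @root_factor (p - p.[a]%:P) a.
  by rewrite rootE !hornerE subrr.
have pE' x : p.[x] = p.[a] + q.[x] * (x - a).
  by apply/eqP; rewrite addrC -subr_eq; apply/eqP;
    have := congr1 (horner^~ x) pE; rewrite !hornerE.
have qa : root q a.
  rewrite rootE eq_le; apply/andP; split.
    rewrite -oppr_ge0 -hornerN.
    apply: (horner_ge0_right a1) => x /andP[ax x1]; rewrite hornerN oppr_ge0.
    have := pa x; rewrite pE' (ltW x1) (ltW (lt_trans a0 ax)) => /(_ isT).
    by rewrite gerDl pmulr_lle0// subr_gt0.
  apply: (horner_ge0_left a0) => x /andP[x0 xa].
  have := pa x; rewrite pE' (ltW x0) (ltW (lt_trans xa a1)) => /(_ isT).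
  by rewrite gerDl nmulr_lle0// subr_lt0.
have [t qE _] := root_factor qa; exists t.
  by rewrite expr2 mulrA -qE -pE addrC subrK.
have pE2 : p = p.[a]%:P + t * ('X - a%:P) * ('X - a%:P).
  by rewrite -qE -pE addrC subrK.
have dE : p^`() = (t^`() * ('X - a%:P) + 2 *: t) * ('X - a%:P).
  rewrite pE2 derivD derivC add0r !derivM !derivXsubC mulr1 scaler_nat mulr2n.
  by ring.
have ddE : p^`()^`().[a] = 2 * t.[a].
  rewrite dE derivM derivXsubC mulr1 hornerD hornerM hornerXsubC subrr mulr0 add0r.
  by rewrite hornerD hornerM hornerXsubC subrr mulr0 add0r hornerZ.
split; first by rewrite dE !hornerE subrr mulr0.
split; first exact: ddE.
rewrite -oppr_ge0 -hornerN.
apply: (horner_ge0_right a1) => x /andP[ax x1]; rewrite hornerN oppr_ge0.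
have := pa x; rewrite pE' (ltW x1) (ltW (lt_trans a0 ax)) => /(_ isT).
by rewrite qE !hornerE gerDl -mulrA pmulr_lle0// mulr_gt0// subr_gt0.
Qed.

Lemma posdef_quad (A B C s t : R) :
  0 < A -> 0 <= 4 * A * C - B ^+ 2 -> 0 <= A * s ^+ 2 + B * s * t + C * t ^+ 2.
Proof.
move=> A0 D0; rewrite -(pmulr_rge0 _ A0).
have -> : A * (A * s ^+ 2 + B * s * t + C * t ^+ 2) =
  (A * s + B * t / 2) ^+ 2 + (4 * A * C - B ^+ 2) * (t ^+ 2) / 4 by field.
by rewrite addr_ge0 ?sqr_ge0// divr_ge0// mulr_ge0// sqr_ge0.
Qed.

(** Compactness of the segment yields one neighbourhood of [b = 0] that serves every [x]. *)
Lemma near_segment (u v : R) (F : R -> R -> Prop) :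
  (forall a, u <= a <= v -> \forall x \near a & b \near (0 : R), F b x) ->
  \forall b \near (0 : R), forall x, u <= x <= v -> F b x.
Proof.
move=> loc.
have /compact_near_coveringP cov := @segment_compact R u v.
have cov0 := cov R (nbhs (0 : R)) F _.
have : \forall b \near (0 : R), `[u, v]%classic `<=` F b.
  by apply: cov0 => a; rewrite /= in_itv /= => /loc.
by apply: filterS => b h x xI; apply: h; rewrite /= in_itv.
Qed.

(** Up to terms of order [b ^+ 3] this is [e.[y] + b * y * W.[y + b / 2]]. *)
Definition perturb e W b y :=
  e.[y] + b * (y * W.[y]) + b ^+ 2 * (y / 2 * W^`().[y]).

Lemma near_perturb_lt e W a M : e.[a] < M ->
  \forall x \near a & b \near (0 : R), perturb e W b x < M.
Proof.
move=> eM.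
have : 0 < (M%:P - e).[a] by rewrite !hornerE subr_gt0.
move=> /(near2_horner_gt0 (- ('X * W)) (- ((2^-1)%:P * 'X * W^`()))).
apply: filterS => -[x b] /=; rewrite !hornerE /perturb /= => h.
by rewrite -subr_gt0; apply: lt_le_trans h _; rewrite le_eqVlt; apply/orP; left;
  apply/eqP; field.
Qed.

Lemma perturbN e W b y : perturb (- e) (- W) b y = - perturb e W b y.
Proof. by rewrite /perturb derivN !hornerN; ring. Qed.

Lemma near_perturb_gt e W a M : M < e.[a] ->
  \forall x \near a & b \near (0 : R), M < perturb e W b x.
Proof.
move=> Me; have : (- e).[a] < - M by rewrite hornerN ltrN2.
move=> /(near_perturb_lt (- W)); apply: filterS => -[x b] /=.
by rewrite perturbN ltrN2.
Qed.

(* At an extremal point the expansion of [e.[a] - perturb e W b x] is a quadratic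
   form with variable coefficients in [(x - a, b)]; the assumptions make it
   positive definite at [x = a]. *)
Lemma near_perturb_interior e W a :
  0 < a < 1 -> (forall x, 0 <= x <= 1 -> e.[x] <= e.[a]) ->
  W.[a] = 0 -> W^`().[a] != 0 -> W^`().[a] ^+ 2 <= W^`().[a] * e^`()^`().[a] ->
  \forall x \near a & b \near (0 : R), perturb e W b x <= e.[a].
Proof.
move=> a01 ea Wa W'a WG; have /andP[a0 a1] := a01.
have [q eE [_ [e2 q0]]] := interior_max_deriv a01 ea.
have [w WE w1] := root_factor (introT rootP Wa).
have W2 : 0 < W^`().[a] ^+ 2 by rewrite exprn_even_gt0.
have qa : 0 < (- q).[a].
  rewrite hornerN oppr_gt0 lt_neqAle q0 andbT; apply/eqP => qa.
  by move: (lt_le_trans W2 WG); rewrite e2 qa !mulr0 ltxx.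
(* The discriminant condition of the quadratic form at [a]. It is strict because [a < 1] gains a
   factor [a] on the square of the derivative of [W]. *)
have : 0 < (4%:P * (- q) * (- ((2^-1)%:P * 'X * W^`())) - ('X * w) ^+ 2).[a].
  rewrite !hornerE w1.
  have -> : 4 * - q.[a] * - (2^-1 * a * W^`().[a]) - (a * W^`().[a]) ^+ 2 =
    a * (W^`().[a] * (2 * q.[a]) - a * W^`().[a] ^+ 2) by field.
  rewrite mulr_gt0// subr_gt0 -e2; apply: lt_le_trans WG.
  by rewrite gtr_pMl.
move=> /(near2_horner_gt0 0 0) D.
apply: filterS2 D (near2_horner_gt0 0 0 qa) => -[x b] /=.
rewrite !hornerE /= ?mulr0 ?addr0 => D0 A0.
rewrite -subr_ge0 /perturb.
have -> : e.[x] = e.[a] + q.[x] * (x - a) ^+ 2 by rewrite {1}eE !hornerE.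
have -> : W.[x] = w.[x] * (x - a) by rewrite WE !hornerE.
have -> : e.[a] - (e.[a] + q.[x] * (x - a) ^+ 2 + b * (x * (w.[x] * (x - a))) +
    b ^+ 2 * (x / 2 * W^`().[x])) =
    - q.[x] * (x - a) ^+ 2 + - (x * w.[x]) * (x - a) * b +
    - (2^-1 * x * W^`().[x]) * b ^+ 2 by field.
by apply: posdef_quad A0 _; rewrite sqrrN ltW.
Qed.

(** Write [e.[x] - e.[1] = u.[x] * (x - 1)]. As [W.[1] = u.[1]], also [x * W.[x] - u.[x] = v.[x] *
    (x - 1)]. The gap to [e.[1]] then splits into a multiple of [1 - b - x] and a multiple of
    [b ^+ 2]; the first coefficient is positive near [u.[1]], the second is at least [W.[1] > 0] at
    [x = 1], [b = 0]. *)
Lemma near_perturb_right_end e W :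
  W.[1] = e^`().[1] -> 0 < e^`().[1] -> e^`()^`().[1] <= W^`().[1] ->
  \forall x \near (1 : R) & b \near (0 : R), x <= 1 - b ->
    perturb e W b x <= e.[1].
Proof.
move=> W1 e10 eW.
have [|u uE u1] := @root_factor (e - e.[1]%:P) 1.
  by rewrite rootE hornerD hornerN hornerC subrr.
have eE : e = u * ('X - 1%:P) + e.[1]%:P by rewrite -uE subrK.
rewrite derivB derivC subr0 in u1.
have u2 : e^`()^`().[1] = 2 * u^`().[1].
  rewrite eE derivD derivC addr0 derivM derivXsubC mulr1 derivD derivM derivXsubC.
  by rewrite mulr1 !hornerD hornerM hornerXsubC subrr mulr0 add0r mulr_natl.
have [|v vE v1] := @root_factor ('X * W - u) 1.
  by rewrite rootE hornerD hornerN hornerM hornerX mul1r W1 u1 subrr.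
have {}v1 : v.[1] = W.[1] + W^`().[1] - u^`().[1].
  rewrite v1 derivB derivM derivX mul1r hornerD hornerN hornerD hornerM hornerX.
  by rewrite mul1r.
have u0 : 0 < u.[1] by rewrite u1.
have : 0 < (v - (2^-1)%:P * 'X * W^`()).[1].
  by rewrite !hornerE v1 W1; lra.
move=> /(near2_horner_gt0 0 0); apply: filterS2 (near2_horner_gt0 v 0 u0).
move=> [x b] /=; rewrite !hornerE /= ?mulr0 ?addr0 => h1 h2 xb.
have vx : x * W.[x] = u.[x] + v.[x] * (x - 1).
  by have := congr1 (horner^~ x) vE; rewrite !hornerE => <-; ring.
have ex : e.[x] = u.[x] * (x - 1) + e.[1] by rewrite {1}eE !hornerE.
rewrite -subr_ge0 /perturb ex vx.
have -> : e.[1] - (u.[x] * (x - 1) + e.[1] + b * (u.[x] + v.[x] * (x - 1)) +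
    b ^+ 2 * (x / 2 * W^`().[x])) =
    (1 - b - x) * (u.[x] + b * v.[x]) +
    b ^+ 2 * (v.[x] - 2^-1 * x * W^`().[x]) by field.
by rewrite addr_ge0// mulr_ge0 ?sqr_ge0 ?(ltW h1) ?(ltW h2) ?subr_ge0.
Qed.

(** Both [e.[x] - e.[0]] and the correction terms carry a factor [x]; after removing it, the
    positive slope of [e] at 0 dominates for small [b]. *)
Lemma near_perturb_left_end e W :
  0 < e^`().[0] ->
  \forall x \near (0 : R) & b \near (0 : R), 0 <= x -> e.[0] <= perturb e W b x.
Proof.
move=> e10.
have [|u uE u1] := @root_factor (e - e.[0]%:P) 0.
  by rewrite rootE hornerD hornerN hornerC subrr.
have eE : e = u * ('X - 0%:P) + e.[0]%:P by rewrite -uE subrK.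
rewrite derivB derivC subr0 in u1.
have : 0 < u.[0] by rewrite u1.
move=> /(near2_horner_gt0 W ((2^-1)%:P * W^`())).
apply: filterS => -[x b] /=; rewrite !hornerE /= => h x0.
rewrite -subr_ge0 /perturb.
have -> : e.[x] = u.[x] * x + e.[0] by rewrite {1}eE !hornerE; ring.
have -> : u.[x] * x + e.[0] + b * (x * W.[x]) + b ^+ 2 * (x / 2 * W^`().[x]) - e.[0] =
  x * (u.[x] + b * W.[x] + b ^+ 2 / 2 * W^`().[x]) by field.
by rewrite mulr_ge0// ltW.
Qed.

Lemma perturb_bounded e W (E : R) :
  0 < E -> (forall x, 0 <= x <= 1 -> `|e.[x]| <= E) ->
  e.[0] = - E -> 0 < e^`().[0] ->
  `|e.[1]| = E -> W.[1] = e^`().[1] -> e^`().[1] != 0 ->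
  0 <= (W^`().[1] - e^`()^`().[1]) * e^`().[1] ->
  (forall a, 0 < a < 1 -> `|e.[a]| = E ->
    [/\ W.[a] = 0, W^`().[a] != 0 & W^`().[a] ^+ 2 <= W^`().[a] * e^`()^`().[a]]) ->
  \forall b \near (0 : R), forall x, 0 <= x <= 1 - b -> `|perturb e W b x| <= E.
Proof.
move=> E0 eE e0 e0' e1 W1 e1' eW int.
have eEr x : 0 <= x <= 1 -> e.[x] <= E.
  by move=> /eE; rewrite ler_norml => /andP[].
have eEl x : 0 <= x <= 1 -> (- e).[x] <= E.
  by move=> /eE; rewrite hornerN lerNl ler_norml => /andP[].
(* Since the absolute value of [e] is largest at the right end 1, the slope there has the sign of
   [e.[1]]. *)
have e1E : e.[1] * e^`().[1] = E * `|e^`().[1]|.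
  have [|u uE u1] := @root_factor (e - e.[1]%:P) 1.
    by rewrite rootE hornerD hornerN hornerC subrr.
  have ex x : e.[x] = e.[1] + u.[x] * (x - 1).
    have := congr1 (horner^~ x) uE; rewrite !hornerE => <-; ring.
  rewrite derivB derivC subr0 in u1; rewrite -u1.
  have [e1p|e1n] := leP 0 e.[1].
    rewrite ger0_norm// in e1; rewrite e1 ger0_norm//.
    apply: (horner_ge0_left ltr01) => x /andP[x0 x1].
    have := eEr x; rewrite (ltW x0) (ltW x1) => /(_ isT).
    by rewrite ex e1 gerDl nmulr_lle0// subr_lt0.
  rewrite ltr0_norm// in e1.
  rewrite ler0_norm; first by rewrite -e1; ring.
  rewrite -oppr_ge0 -hornerN; apply: (horner_ge0_left ltr01) => x /andP[x0 x1].
  have := eEl x; rewrite hornerN (ltW x0) (ltW x1) => /(_ isT).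
  by rewrite ex -e1 opprD gerDl oppr_le0 nmulr_lge0 ?subr_lt0// hornerN oppr_ge0.
(* At an endpoint one of the two bounds holds only under a side condition on [(x, b)], recorded by
   [P] for the upper and [Q] for the lower bound. *)
have combine (P Q : R * R -> Prop) a :
    (\forall x \near a & b \near (0 : R), P (x, b) -> perturb e W b x <= E) ->
    (\forall x \near a & b \near (0 : R), Q (x, b) -> - E <= perturb e W b x) ->
    (forall x b, 0 <= x -> x <= 1 - b -> P (x, b) /\ Q (x, b)) ->
    \forall x \near a & b \near (0 : R),
      0 <= x -> x <= 1 - b -> `|perturb e W b x| <= E.
  move=> hP hQ PQ; apply: filterS2 hP hQ => -[x b] /= hP hQ x0 xb.
  by rewrite ler_norml; have [/hP -> /hQ ->] := PQ x b x0 xb.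
have upper a : e.[a] < E ->
    \forall x \near a & b \near (0 : R), True -> perturb e W b x <= E.
  by move=> /(near_perturb_lt W); apply: filterS => -[x b] /= /ltW.
have lower a : - E < e.[a] ->
    \forall x \near a & b \near (0 : R), True -> - E <= perturb e W b x.
  by move=> /(near_perturb_gt W); apply: filterS => -[x b] /= /ltW.
(* For negative [b] the range [x <= 1 - b] passes beyond 1, hence a segment up to 2. Near a point
   [a > 1] the constraint [x <= 1 - b] fails for small [b]. *)
have loc a : 0 <= a <= 2 -> \forall x \near a & b \near (0 : R),
    0 <= x -> x <= 1 - b -> `|perturb e W b x| <= E.
  move=> /andP[]; rewrite le_eqVlt => /predU1P[<- _|a0 _].
    apply: (combine (fun=> True) (fun z => 0 <= z.1)).
    - by apply: upper; rewrite e0; lra.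
    - by rewrite -e0; exact: near_perturb_left_end.
    - by [].
  have [a1|a1|->] := ltrgtP a 1; last first.
  - have [e1pos|e1neg] := ltP 0 e.[1].
    + move: e1; rewrite gtr0_norm// => e1.
      apply: (combine (fun z => z.1 <= 1 - z.2) (fun=> True)) => //; last first.
        by apply: lower; lra.
      have e1'0 : 0 < e^`().[1].
        rewrite lt_neqAle eq_sym e1' /= -(pmulr_rge0 _ E0).
        by move: e1E; rewrite e1 => ->; rewrite mulr_ge0 ?normr_ge0 ?(ltW E0).
      have := near_perturb_right_end W1 e1'0; rewrite e1; apply.
      by move: eW; rewrite pmulr_lge0// subr_ge0.
    + move: e1; rewrite ler0_norm// => e1.
      apply: (combine (fun=> True) (fun z => z.1 <= 1 - z.2)) => //.
        by apply: upper; lra.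
      have e1'0 : e^`().[1] < 0.
        rewrite lt_neqAle e1' /= -(nmulr_rge0 _ (x := - E)) ?oppr_lt0//.
        by rewrite -e1 opprK e1E mulr_ge0 ?normr_ge0 ?(ltW E0).
      have : \forall x \near (1 : R) & b \near (0 : R), x <= 1 - b ->
          perturb (- e) (- W) b x <= (- e).[1].
        apply: near_perturb_right_end.
        - by rewrite derivN !hornerN W1.
        - by rewrite derivN hornerN oppr_gt0.
        - by rewrite !derivN !hornerN lerN2 -subr_le0 -(nmulr_lge0 _ e1'0).
      apply: filterS => -[x b] /= h /h.
      by rewrite perturbN hornerN e1 lerNl.
  - have : 0 < ('X - 1%:P).[a] by rewrite !hornerE subr_gt0.
    move=> /(near2_horner_gt0 1%:P 0); apply: filterS => -[x b] /=.
    by rewrite !hornerE /= => h _ xb; exfalso; lra.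
  have a01 : 0 < a < 1 by rewrite a0.
  have a01' : 0 <= a <= 1 by rewrite !ltW.
  have := eE _ a01'; rewrite le_eqVlt => /predU1P[ea|]; last first.
    rewrite ltr_norml => /andP[h1 h2].
    by apply: (combine (fun=> True) (fun=> True)); [exact: upper|exact: lower|].
  have [Wa W'a WG] := int _ a01 ea.
  have [e_ge0|e_lt0] := leP 0 e.[a].
    rewrite ger0_norm// in ea.
    apply: (combine (fun=> True) (fun=> True)) => //; last by apply: lower; lra.
    have := near_perturb_interior a01 _ Wa W'a WG; rewrite ea => /(_ eEr).
    by apply: filterS.
  rewrite ltr0_norm// in ea.
  apply: (combine (fun=> True) (fun=> True)) => //; first by apply: upper; lra.
  have : \forall x \near a & b \near (0 : R), perturb (- e) (- W) b x <= (- e).[a].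
    apply: near_perturb_interior => //.
    - by move=> x x01; rewrite (hornerN e a) ea eEl.
    - by rewrite hornerN Wa oppr0.
    - by rewrite derivN hornerN oppr_eq0.
    - by rewrite !derivN !hornerN sqrrN mulrNN.
  by apply: filterS => -[x b] /=; rewrite perturbN hornerN ea lerNl.
have : \forall b \near (0 : R), - 1 < b.
  by apply: (cvgr_gt (0 : R) cvg_id); rewrite ltrN10.
apply: filterS2 (near_segment loc) => b h b1 x /andP[x0 xb]; apply: h => //.
by rewrite x0; lra.
Qed.
End Local.

(** * Reduction to polynomials in [x ^+ 2] on the unit interval *)

Section EvenReduction.
Variable R : realType.
Implicit Types (p q P v : {poly R}) (a x M : R) (n m : nat).

Lemma best_error_le n a q M : (size q <= n.+1)%N ->
  (forall x, -1 <= x <= 1 -> `| `|x - a| - q.[x]| <= M) -> best_error n a <= M.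
Proof.
move=> sq qM; apply: (@le_trans _ _ (unorm (fun x => shifted_abs a x - q.[x]))).
  apply: ge_inf; last by exists q.
  exists 0 => _ [p _ <-]; apply: unorm_ge0; apply: bounded11B.
    exact: bounded11_shifted_abs.
  exact: bounded11_poly.
by apply: unorm_le => x xI; apply: qM; rewrite in_itv in xI.
Qed.

Lemma size_comp_sqr P m : (size P <= m.+1)%N -> (size (P \Po 'X^2) <= m.*2.+1)%N.
Proof.
move=> sP; apply: leq_trans (size_comp_poly_leq _ _) _.
by rewrite size_polyXn /= muln2 ltnS leq_double; case: (size P) sP.
Qed.

Lemma best_error0_le m P M : (size P <= m.+1)%N ->
  (forall x, 0 <= x <= 1 -> `|x - P.[x ^+ 2]| <= M) -> best_error m.*2.+1 0 <= M.
Proof.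
move=> sP PM; apply: (@best_error_le _ _ (P \Po 'X^2)).
  exact: leq_trans (size_comp_sqr sP) _.
move=> x; rewrite -ler_norml => x1; rewrite subr0 horner_comp hornerXn.
by rewrite -real_normK ?num_real// PM// normr_ge0.
Qed.

(** The target is even, so averaging a best approximation with its reflection does not raise the
    error. This leaves the even part, of degree at most [2m] when the degree bound is [2m + 1]. *)
Lemma best_error0_even m : exists2 P : {poly R}, (size P <= m.+1)%N &
  forall x, 0 <= x <= 1 -> `|x - P.[x ^+ 2]| <= best_error m.*2.+1 0.
Proof.
have [q sq qE] := best_error_attained m.*2.+1 (0 : R).
exists (even_poly q) => [|x /andP[x0 x1]].
  apply: leq_trans (size_even_poly _) _.
  by apply: leq_trans (uphalf_leq sq) _; rewrite /= uphalf_double.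
have qb y : -1 <= y <= 1 -> `| `|y| - q.[y]| <= best_error m.*2.+1 0.
  move=> yI; rewrite -qE.
  have <- : shifted_abs 0 y = `|y| by rewrite /shifted_abs subr0.
  apply: (@unorm_ge _ (fun z => shifted_abs 0 z - q.[z])); last by rewrite in_itv.
  by apply: bounded11B; [exact: bounded11_shifted_abs|exact: bounded11_poly].
have qx y : q.[y] = (even_poly q).[y ^+ 2] + (odd_poly q).[y ^+ 2] * y.
  by rewrite -[in LHS](poly_even_odd q) hornerD hornerM hornerX !horner_comp hornerXn.
have := qb x _; have := qb (- x) _; rewrite normrN (ger0_norm x0) !qx sqrrN !ler_norml.
by move=> /(_ ltac:(lra))/andP[? ?] /(_ ltac:(lra))/andP[? ?]; apply/andP; split; lra.
Qed.
End EvenReduction.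

(** * Extremal points of the best even approximation *)

Section BestApproximation.
Variable R : realType.
Implicit Types (p q u v : {poly R}) (a x M : R) (s : seq R).

Lemma horner_norm_lt_bound p E : (forall x, 0 <= x <= 1 -> `|p.[x]| < E) ->
  exists2 M, M < E & forall x, 0 <= x <= 1 -> `|p.[x]| <= M.
Proof.
move=> pE.
have [|c cI cmax] := @EVT_max R (fun x => `|p.[x]|) 0 1 ler01.
  apply: continuous_subspaceT => x.
  by apply: continuous_comp; [exact: continuous_horner|exact: norm_continuous].
exists `|p.[c]| => [|x xI]; last by apply: cmax; rewrite in_itv.
by apply: pE; rewrite in_itv in cI.
Qed.

(* Kolmogorov's criterion: moving [e] in a direction that has its sign at all
   its extremal points lowers its norm. *)
Lemma lower_error e u E : 0 < E -> (forall x, 0 <= x <= 1 -> `|e.[x]| <= E) ->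
  (forall a, 0 <= a <= 1 -> `|e.[a]| = E -> 0 < e.[a] * u.[a]) ->
  exists b M, M < E /\ forall x, 0 <= x <= 1 -> `|(e - b *: u).[x]| <= M.
Proof.
move=> E0 eE eu.
have loc a : 0 <= a <= 1 -> \forall x \near a & b \near (0 : R),
    0 <= x <= 1 -> 0 < b -> `|(e - b *: u).[x]| < E.
  move=> aI; have := eE a aI; rewrite le_eqVlt => /predU1P[ea|].
    have : 0 < (2%:P * e * u).[a] by rewrite !hornerE -mulrA mulr_gt0// eu.
    move=> /(near2_horner_gt0 (- (u * u)) 0); apply: filterS => -[x b] /=.
    rewrite !hornerE /= => h xI b0.
    have eb : e.[x] ^+ 2 <= E ^+ 2.
      by rewrite -(real_normK (num_real e.[x])) lerXn2r ?nnegrE ?eE// ltW.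
    rewrite -(ltr_pXn2r (n := 2)) ?nnegrE ?(ltW E0)// real_normK ?num_real//.
    apply: lt_le_trans eb; rewrite -subr_gt0.
    have -> : e.[x] ^+ 2 - (e.[x] - b * u.[x]) ^+ 2 =
      b * (2 * e.[x] * u.[x] + b * - (u.[x] * u.[x])) by ring.
    by apply: mulr_gt0 => //; lra.
  rewrite ltr_norml => /andP[e1 e2].
  have : 0 < (E%:P - e).[a] by rewrite !hornerE subr_gt0.
  move=> /(near2_horner_gt0 u 0) h1.
  have : 0 < (E%:P + e).[a] by rewrite !hornerE -ltrBlDl sub0r.
  move=> /(near2_horner_gt0 (- u) 0); apply: filterS2 h1 => -[x b] /=.
  rewrite !hornerE /= => h1 h2 _ _.
  by rewrite ltr_norml; apply/andP; split; lra.
have := near_segment loc; rewrite -nbhs_nearE => /nbhs_ballP[d /= d0 db].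
have d20 : 0 < d / 2 by rewrite divr_gt0.
have /horner_norm_lt_bound[M ME hM] x :
    0 <= x <= 1 -> `|(e - (d / 2) *: u).[x]| < E.
  move=> xI; apply: db => //; rewrite -ball_normE /= sub0r normrN gtr0_norm//.
  by rewrite ltr_pdivrMr// mulr_natr mulr2n ltrDl.
by exists (d / 2), M.
Qed.

Definition even_error p : {poly R} := 'X - (p \Po 'X^2).

Lemma horner_even_error p x : (even_error p).[x] = x - p.[x ^+ 2].
Proof. by rewrite /even_error hornerD hornerN hornerX horner_comp hornerXn. Qed.

Lemma deriv_even_error p x :
  (even_error p)^`().[x] = 1 - x * (2 *: p^`()).[x ^+ 2].
Proof.
rewrite /even_error derivB derivX deriv_comp derivXn /= expr1 hornerD hornerN hornerC.
by rewrite hornerM hornerMn hornerX horner_comp hornerXn hornerZ; ring.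
Qed.

Section Best.
Variables (m : nat) (p : {poly R}) (E : R).
Hypothesis sp : (size p <= m.+1)%N.
Let e := even_error p.
Hypothesis eE : forall x, 0 <= x <= 1 -> `|e.[x]| <= E.
Hypothesis Emin : forall q M, (size q <= m.+1)%N ->
  (forall x, 0 <= x <= 1 -> `|(even_error q).[x]| <= M) -> E <= M.

Let eEr x : 0 <= x <= 1 -> e.[x] <= E.
Proof. by move=> /eE; rewrite ler_norml => /andP[]. Qed.

Let eEl x : 0 <= x <= 1 -> (- e).[x] <= E.
Proof. by move=> /eE; rewrite hornerN lerNl ler_norml => /andP[]. Qed.

Let e'0 : e^`().[0] = 1.
Proof. by rewrite deriv_even_error mul0r subr0. Qed.

(** The slope 1 at 0 makes [e] increase there. This excludes the value [E] at 0 and the case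
    [E = 0]. *)
Let e_left_max (M : R) : (forall x, 0 < x < 1 -> e.[x] <= M) -> e.[0] < M.
Proof.
move=> eM; rewrite ltNge; apply/negP => Me.
have [|u uE u1] := @root_factor _ (e - e.[0]%:P) 0.
  by rewrite rootE hornerD hornerN hornerC subrr.
rewrite derivB derivC subr0 e'0 in u1.
suff : 0 <= (- u).[0].
  by rewrite hornerN u1 => h; lra.
apply: (horner_ge0_right ltr01) => x /[dup] /eM ex /andP[x0 _].
have := congr1 (horner^~ x) uE.
rewrite hornerM hornerXsubC subr0 hornerD !hornerN hornerC.
by rewrite oppr_ge0 -(pmulr_lle0 _ x0) => <-; rewrite subr_le0 (le_trans ex).
Qed.

Lemma best_gt0 : 0 < E.
Proof.
have E0 : 0 <= E by apply: le_trans (eE (x := 0) _); rewrite ?lexx ?ler01.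
rewrite lt_neqAle E0 andbT; apply/eqP => E0'.
have : e.[0] < 0.
  by apply: e_left_max => x /andP[x0 x1]; rewrite E0' eEr// !ltW.
by have := eE (x := 0); rewrite lexx ler01 -E0' normr_le0 => /(_ isT)/eqP ->;
  rewrite ltxx.
Qed.

Lemma best_left_end : `|e.[0]| = E -> e.[0] = - E.
Proof.
have : e.[0] < E by apply: e_left_max => x /andP[x0 x1]; rewrite eEr// !ltW.
by have [e0|e0] := leP 0 e.[0]; [rewrite ger0_norm//|rewrite ltr0_norm//]; lra.
Qed.

Lemma extremal_deriv0 a : 0 < a < 1 -> `|e.[a]| = E -> e^`().[a] = 0.
Proof.
move=> a01; have [ea|ea] := leP 0 e.[a].
  rewrite ger0_norm// => eaE; have [|? _ []//] := interior_max_deriv a01 (p := e).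
  by rewrite eaE.
rewrite ltr0_norm// => eaE; have [|? _ []] := interior_max_deriv a01 (p := - e).
  by rewrite hornerN eaE.
by rewrite derivN hornerN => /eqP; rewrite oppr_eq0 => /eqP.
Qed.

(** With at most [m.+1] points, some polynomial in [x ^+ 2] of admissible degree would agree with
    [e] on all of [s], and moving along it would lower the error below the minimum [E]. *)
Lemma extremal_many s : uniq s -> (forall a, a \in s -> 0 <= a) ->
  (forall a, 0 <= a <= 1 -> `|e.[a]| = E -> a \in s) -> (m.+1 < size s)%N.
Proof.
move=> us s0 sE; rewrite ltnNge; apply/negP => ss.
have usq : uniq [seq a ^+ 2 | a <- s].
  rewrite map_inj_in_uniq// => a b as_ bs /eqP.
  by rewrite eqrXn2 ?s0// => /eqP.
have [v sv vE] := poly_interpolation (fun t => e.[Num.sqrt t]) usq.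
rewrite size_map in sv.
have [|b [M [ME eM]]] := lower_error (u := v \Po 'X^2) best_gt0 eE.
  move=> a aI ea; rewrite horner_comp hornerXn vE; last first.
    by apply: map_f; exact: sE.
  rewrite sqrtr_sqr ger0_norm; last by case/andP: aI.
  by rewrite -expr2 -(real_normK (num_real _)) ea exprn_gt0 ?best_gt0.
move: ME; rewrite ltNge => /negP; apply; apply: (Emin (q := p + b *: v)).
  rewrite (leq_trans (size_polyD _ _))// geq_max sp.
  exact: leq_trans (size_scale_leq _ _) (leq_trans sv ss).
move=> x /eM; rewrite /e !(hornerD, hornerN, hornerZ, horner_even_error, horner_comp).
by rewrite hornerXn opprD addrA.
Qed.

Let extremal s := uniq s /\ forall a, a \in s -> 0 < a < 1 /\ `|e.[a]| = E.

Let size_extremal s : extremal s -> (size s <= size (2 *: p^`()))%N.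
Proof.
move=> [us sE]; apply: inv_interpolation_size => // a /sE[a01 ea].
  by case/andP: a01.
have := extremal_deriv0 a01 ea; rewrite deriv_even_error => /eqP.
by rewrite subr_eq0 => /eqP.
Qed.

Let size_p' : (size (2 *: p^`())%R <= m)%N.
Proof.
apply: leq_trans (size_scale_leq _ _) _; apply: leq_trans (size_poly _ _) _.
by case: (size p) sp.
Qed.

Lemma best_extremal : exists s,
  [/\ uniq s, size s = m, (forall a, a \in s -> 0 < a < 1 /\ `|e.[a]| = E),
   (forall a, 0 < a < 1 -> `|e.[a]| = E -> a \in s) & `|e.[0]| = E /\ `|e.[1]| = E].
Proof.
(* Were no list of interior extremal points complete, lists could be extended to length [m.+1],
   beyond the bound by zeros of the derivative. *)
have [s [us sE] smax] : exists2 s, extremal s &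
    forall a, 0 < a < 1 -> `|e.[a]| = E -> a \in s.
  apply: contrapT => H.
  have {}H s : extremal s -> exists a, extremal (a :: s).
    move=> es; apply: contrapT => Hs; apply: H; exists s => // a a01 ea.
    apply: contrapT => /negP as_; apply: Hs; exists a; case: es => us sE.
    split; first by rewrite /= as_.
    by move=> c; rewrite inE => /predU1P[->|/sE].
  have [s es sm] : exists2 s, extremal s & size s = m.+1.
    elim: m.+1 => [|k [s es sk]]; first by exists [::].
    by have [a ea] := H s es; exists (a :: s) => //=; rewrite sk.
  by have := leq_trans (size_extremal es) size_p'; rewrite sm ltnn.
have sm := leq_trans (size_extremal (conj us sE)) size_p'.
have s0 : 0 \notin s by apply/negP => /sE[]; rewrite ltxx.
have s1 : 1 \notin s by apply/negP => /sE[]; rewrite ltxx andbF.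
(* [l] lists the ends that may be extremal. Both ends together give [m <= size s]; if one end were
   not extremal, [l] could omit it and [s] would have more than [m] points. *)
have sub (l : seq R) : uniq l -> all (mem [:: 0; 1]) l ->
    (`|e.[0]| = E -> 0 \in l) -> (`|e.[1]| = E -> 1 \in l) ->
    (m.+1 < size (l ++ s))%N.
  move=> ul l01 l0 l1; apply: extremal_many.
  - rewrite cat_uniq ul us andbT /=; apply/hasPn => a /= as_.
    apply/negP => /(allP l01); rewrite !inE => /orP[] /eqP aE;
      by move: as_; rewrite aE ?(negPf s0) ?(negPf s1).
  - move=> a; rewrite mem_cat => /orP[/(allP l01)|/sE[/andP[/ltW]]//].
    by rewrite !inE => /orP[] /eqP ->.
  - move=> a /andP[]; rewrite mem_cat le_eqVlt => /predU1P[<- _ /l0 -> //|a0].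
    rewrite le_eqVlt => /predU1P[-> /l1 -> //|a1] ea.
    by rewrite (smax a) ?orbT// a0.
have ms : (m <= size s)%N.
  by apply: (sub [:: 0; 1]); rewrite /= !inE ?eqxx ?orbT// eq_sym oner_eq0.
exists s; split => //; first by apply/eqP; rewrite eqn_leq sm.
split; apply: contrapT => H; have := sm; rewrite leqNgt => /negP; apply.
  by apply: (sub [:: 1]) => //=; rewrite !inE ?eqxx ?orbT.
by apply: (sub [:: 0]) => //=; rewrite !inE ?eqxx.
Qed.

End Best.
End BestApproximation.

(** * Construction of the correction [W] *)

Section Correction.
Variable R : realType.
Implicit Types (a x : R) (s : seq R).

Lemma deriv_prod_sqr_neq0 s a : uniq s -> (forall b, b \in s -> 0 < b) ->
  a \in s -> ((\prod_(b <- s) ('X - (b ^+ 2)%:P)) \Po 'X^2)^`().[a] != 0.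
Proof.
move=> us s0 as_; have a0 := s0 a as_.
rewrite deriv_comp derivXn /= expr1 hornerM horner_comp hornerXn hornerMn hornerX.
rewrite mulf_neq0 ?mulrn_eq0 ?(gt_eqF a0)//.
rewrite (big_rem a)//= derivM derivXsubC mul1r hornerD hornerM hornerXsubC subrr.
rewrite mul0r addr0 horner_prod_sqr prodf_seq_neq0; apply/allP => b /= bs.
rewrite subr_eq0 eqrXn2 ?(ltW a0) ?(ltW (s0 b _)) ?(mem_rem bs)//.
by apply: contraTneq bs => <-; rewrite mem_rem_uniqF.
Qed.

(* [W / e'] is [f 1 / f] for a positive decreasing function [f]; the conditions on
   the derivatives of [W] are limits of this monotonicity at the [a] and at 1. *)
Lemma correction_poly s (p : {poly R}) (e := even_error p) :
  uniq s -> (size p <= (size s).+1)%N ->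
  (forall a, a \in s -> 0 < a < 1 /\ e^`().[a] = 0) ->
  exists w : {poly R}, let W := w \Po 'X^2 in
  [/\ (size w <= (size s).+1)%N, W.[1] = e^`().[1], e^`().[1] != 0,
    0 <= (W^`().[1] - e^`()^`().[1]) * e^`().[1] &
    forall a, a \in s ->
    [/\ W.[a] = 0, W^`().[a] != 0 & W^`().[a] ^+ 2 <= W^`().[a] * e^`()^`().[a]]].
Proof.
move=> us sp sE.
have s0 a : a \in s -> 0 < a by move=> /sE[/andP[]].
have [|a /sE[_]|f Cf fE] := inv_interpolation_error us s0 (r := 2 *: p^`()).
- apply: leq_trans (size_scale_leq _ _) _; apply: leq_trans (size_poly _ _) _.
  by case: (size p) sp.
- by rewrite deriv_even_error => /eqP; rewrite subr_eq0 => /eqP.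
pose w0 := \prod_(a <- s) ('X - (a ^+ 2)%:P) : {poly R}.
pose M x := \prod_(a <- s) (x ^+ 2 - a ^+ 2).
(* This is the value at 1 of the derivative of [e] divided by [M 1], so [W] agrees with that
   derivative at 1. *)
pose c := (-1) ^+ size s * f 1.
have f0 x : 0 < x -> 0 < f x by exact: recip_cone_gt0.
have f1 := f0 1 ltr01.
have c0 : c != 0 by rewrite mulf_neq0 ?signr_eq0 ?gt_eqF.
have M0 x : 1 <= x -> 0 < M x.
  move=> x1; rewrite /M big_seq; apply: prodr_gt0 => a /sE[/andP[a0 a1] _].
  by rewrite subr_gt0 ltrXn2r ?ltW// ?(lt_le_trans a1).
have GE x : 0 < x -> e^`().[x] = (-1) ^+ size s * f x * M x.
  by move=> x0; rewrite deriv_even_error fE.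
exists (c *: w0) => W.
have WE x : W.[x] = c * M x.
  by rewrite /W horner_comp hornerXn hornerZ horner_prod_sqr.
have fW x : 0 < x -> f 1 * e^`().[x] = f x * W.[x].
  by move=> x0; rewrite GE// WE /c; ring.
have W1 : W.[1] = e^`().[1] by rewrite WE GE.
split => //.
- by rewrite (leq_trans (size_scale_leq _ _))// size_prod_XsubC.
- by rewrite -W1 WE mulf_neq0// gt_eqF// M0.
- have [|h hE h1] := @root_factor _ (W - e^`()) 1.
    by rewrite rootE hornerD hornerN W1 subrr.
  rewrite derivB hornerD hornerN in h1; rewrite -h1 mulrC -hornerZ.
  (* The sign at 1 is a limit from the right, where [M] is positive and [f x <= f 1]; any upper end
     beyond 1 would do. *)
  apply: (@horner_ge0_right _ _ _ 2); first by lra.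
  move=> x /andP[x1 x2]; have x0 : 0 < x by lra.
  have := congr1 (horner^~ x) hE; rewrite hornerM hornerXsubC hornerD hornerN.
  move=> hx; have x10 : 0 < x - 1 by lra.
  rewrite -(pmulr_lge0 _ x10) hornerZ -mulrA -hx -W1 !WE -(pmulr_rge0 _ f1).
  have -> : f 1 * (c * M 1 * (c * M x - e^`().[x])) =
    c * M 1 * (f 1 * (c * M x) - f 1 * e^`().[x]) by ring.
  rewrite fW// WE.
  have -> : c * M 1 * (f 1 * (c * M x) - f x * (c * M x)) =
    c ^+ 2 * (M 1 * M x * (f 1 - f x)) by ring.
  apply: mulr_ge0; first exact: sqr_ge0.
  apply: mulr_ge0; first by rewrite ltW// mulr_gt0 ?M0// ltW.
  by rewrite subr_ge0 (recip_cone_nonincreasing Cf)// ltW.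
- move=> a as_; have [/andP[a0 a1] Ga] := sE a as_.
  have Wa : W.[a] = 0 by rewrite WE /M (big_rem a)//= subrr mul0r mulr0.
  have [w wE w1] := root_factor (introT rootP Wa).
  have [g gE g1] := root_factor (introT rootP Ga).
  split => //.
    by rewrite /W comp_polyZ derivZ hornerZ mulf_neq0// deriv_prod_sqr_neq0.
  rewrite -w1 -g1 -subr_ge0 -horner_exp -hornerM -hornerN -hornerD.
  (* Between [a] and 1, [f x >= f 1]. Cancelling [x - a] in [fW] gives [f 1 * g.[x] = f x * w.[x]],
     and the inequality follows in the limit at [a]. *)
  apply: (horner_ge0_right a1) => x /andP[ax x1].
  have x0 := lt_trans a0 ax; have xa : x - a != 0 by rewrite subr_eq0 gt_eqF.
  have gx : f 1 * g.[x] = f x * w.[x].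
    apply: (mulIf xa); rewrite -!mulrA -!(hornerXsubC a) -!hornerM -wE -gE.
    exact: fW.
  rewrite hornerD hornerN hornerM horner_exp -(pmulr_rge0 _ f1).
  have -> : f 1 * (w.[x] * g.[x] - w.[x] ^+ 2) =
    w.[x] * (f 1 * g.[x]) - f 1 * w.[x] ^+ 2 by ring.
  rewrite gx.
  have -> : w.[x] * (f x * w.[x]) - f 1 * w.[x] ^+ 2 = (f x - f 1) * w.[x] ^+ 2 by ring.
  by rewrite mulr_ge0 ?sqr_ge0// subr_ge0 (recip_cone_nonincreasing Cf)// ltW.
Qed.

End Correction.

(** * The competing polynomial for a shift [a] near 0 *)

Lemma comp_sqr_even (R : realType) (w : {poly R}) (x : R) :
  (w \Po 'X^2).[- x] = (w \Po 'X^2).[x].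
Proof. by rewrite !horner_comp !hornerXn sqrrN. Qed.

Lemma deriv_comp_sqr_odd (R : realType) (w : {poly R}) (x : R) :
  (w \Po 'X^2)^`().[- x] = - (w \Po 'X^2)^`().[x].
Proof.
rewrite deriv_comp derivXn /= expr1 !hornerM !comp_sqr_even !hornerMn !hornerX.
by rewrite mulNrn mulrN.
Qed.

Theorem theorem4 (R : realType) (n : nat) (n_odd : odd n) :
  \forall a \near within `]-1, 1[%classic (nbhs (0 : R)),
    best_error n a <= best_error n 0.
Proof.
have [m ->] : exists m, n = m.*2.+1.
  by exists n./2; rewrite -[LHS]odd_double_half n_odd.
pose E : R := best_error m.*2.+1 0.
have [p sp pE] := best_error0_even R m.
set e := even_error p.
have eE x : 0 <= x <= 1 -> `|e.[x]| <= E.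
  by move=> xI; rewrite horner_even_error pE.
have Emin (q : {poly R}) M : (size q <= m.+1)%N ->
    (forall x, 0 <= x <= 1 -> `|(even_error q).[x]| <= M) -> E <= M.
  move=> sq qM; apply: (best_error0_le sq) => x /qM.
  by rewrite horner_even_error.
have [s [us sm sE smax [e0 e1]]] := best_extremal sp eE Emin.
have [|a /sE[a01 ea]|w [sw W1 e'1 eW Ws]] := @correction_poly R s p us.
- by rewrite sm.
- by split => //; apply: (extremal_deriv0 (E := E)).
set W := w \Po 'X^2 in W1 eW Ws.
have E0 : 0 < E := best_gt0 eE.
have : \forall b \near (0 : R), forall x, 0 <= x <= 1 - b -> `|perturb e W b x| <= E.
  apply: perturb_bounded => //.
  - exact: best_left_end.
  - by rewrite deriv_even_error mul0r subr0.
  - by move=> a a01 ea; apply: Ws; exact: smax.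
rewrite -nbhs_nearE => /nbhs_ballP[d /= d0 db].
rewrite near_withinE; apply/nbhs_ballP; exists d => //= a.
rewrite -ball_normE /= sub0r normrN => ad _.
have Pb b x : `|b| = `|a| -> 0 <= x <= 1 - b -> `|perturb e W b x| <= E.
  by move=> ba; apply: db; rewrite -ball_normE /= sub0r normrN ba.
pose Q := (p \Po 'X^2) - a *: ('X * W) - (a ^+ 2 / 2) *: ('X * W^`()).
(* The terms with ['X * W] reach degree [2m + 1], the full degree allowed. *)
apply: (@best_error_le _ _ _ (Q \Po ('X - a%:P))).
  rewrite size_comp_poly2 ?size_XsubC//.
  have sW := size_comp_sqr sw; rewrite sm in sW.
  have sXW (u : {poly R}) : (size u <= m.*2.+1)%N -> (size ('X * u)%R <= m.*2.+2)%N.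
    by move=> su; rewrite (leq_trans (size_polyMleq _ _))// size_polyX.
  apply: leq_trans (size_polyD _ _) _; rewrite geq_max size_polyN; apply/andP; split.
    apply: leq_trans (size_polyD _ _) _.
    rewrite geq_max size_polyN (leq_trans (size_comp_sqr sp))//=.
    exact: leq_trans (size_scale_leq _ _) (sXW _ sW).
  apply: leq_trans (size_scale_leq _ _) (sXW _ _).
  by rewrite (leq_trans (size_poly _ _))// (leq_trans (leq_pred _)).
move=> x xI; rewrite horner_comp hornerXsubC.
have QE y : Q.[y] = p.[y ^+ 2] - a * (y * W.[y]) - a ^+ 2 / 2 * (y * W^`().[y]).
  by rewrite /Q !(hornerD, hornerN, hornerZ, hornerM, hornerX) horner_comp hornerXn.
have [xa|xa] := leP 0 (x - a).
  have := Pb a (x - a) erefl; rewrite (ger0_norm xa) => /(_ ltac:(lra)).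
  rewrite /perturb horner_even_error QE; congr (`|_| <= _); ring.
(* To the left of [a], put [y = a - x] and [b = - a], so that [x >= -1] becomes [y <= 1 - b]. As [W]
   is even and its derivative odd, only the term linear in [a] changes sign. *)
have := Pb (- a) (- (x - a)) (normrN _); rewrite (ltr0_norm xa) => /(_ ltac:(lra)).
rewrite /perturb horner_even_error QE /W comp_sqr_even deriv_comp_sqr_odd sqrrN.
by congr (`|_| <= _); ring.
Qed.
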